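(* If an intermediate logic $L$ is axiomatized by $\mathsf{NNIL}$-formulas or by $\mathsf{MR}$-formulas, then $L$ has the finite model property.
   Context: Formulas are built from propositional variables and $\bot$ by $\wedge,\vee,\to$ (with $\neg\varphi:=\varphi\to\bot$). An intermediate logic is a set of formulas containing intuitionistic propositional calculus $\mathsf{IPC}$ and closed under modus ponens and substitution; $L$ is axiomatized by a set $\Gamma$ of formulas if it is the least intermediate logic containing $\Gamma$. $L$ has the finite model property if every formula not in $L$ is refuted (fails at some world under some persistent valuation) on a finite Kripke frame validating all formulas of $L$. Kripke frames $(W,R)$ have $R$ a partial order on a nonempty $W$, and models carry persistent valuations, with the standard intuitionistic truth relation. A $\mathsf{NNIL}$-formula is one with no nesting of implications to the left, i.e. no implication occurs in the antecedent of an implication. An $n$-model is a model whose valuation is restricted to $n$ fixed variables $p_1,\dots,p_n$; the color $col(w)\in\{0,1\}^n$ of a world $w$ has $k$-th entry $1$ iff $p_k$ is true at $w$. A color-preserving monotonic map $f:\mathfrak N\to\mathfrak M$ between $n$-models is an order-preserving function on worlds with $col(f(w))=col(w)$. A formula $\varphi$ with variables among $p_1,\dots,p_n$ is an $\mathsf{MR}$-formula if for all $n$-models $\mathfrak N,\mathfrak M$, every color-preserving monotonic $f:\mathfrak N\to\mathfrak M$ and every world $w$ of $\mathfrak N$, $\mathfrak M,f(w)\models\varphi$ implies $\mathfrak N,w\models\varphi$. *)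

(* Defs.v *)
From Stdlib Require Import Relation_Definitions.
From mathcomp Require Import all_boot.
From mathcomp Require Import boolp classical_sets cardinality.

Set Implicit Arguments.
Unset Strict Implicit.
Unset Printing Implicit Defensive.

Local Open Scope classical_set_scope.

Inductive formula : Type :=
| Var of nat
| Bot
| And of formula & formula
| Or of formula & formula
| Imp of formula & formula.

Fixpoint subst (s : nat -> formula) (A : formula) : formula :=
  match A with
  | Var k => s k
  | Bot => Bot
  | And B C => And (subst s B) (subst s C)
  | Or B C => Or (subst s B) (subst s C)
  | Imp B C => Imp (subst s B) (subst s C)
  end.

Fixpoint vars_below (n : nat) (A : formula) : bool :=
  match A with
  | Var k => k < n
  | Bot => true
  | And B C | Or B C | Imp B C => vars_below n B && vars_below n C
  end.

Inductive IPC : set formula :=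
| IPC_K A B : IPC (Imp A (Imp B A))
| IPC_S A B C : IPC (Imp (Imp A (Imp B C)) (Imp (Imp A B) (Imp A C)))
| IPC_andl A B : IPC (Imp (And A B) A)
| IPC_andr A B : IPC (Imp (And A B) B)
| IPC_pair A B : IPC (Imp A (Imp B (And A B)))
| IPC_orl A B : IPC (Imp A (Or A B))
| IPC_orr A B : IPC (Imp B (Or A B))
| IPC_case A B C : IPC (Imp (Imp A C) (Imp (Imp B C) (Imp (Or A B) C)))
| IPC_efq A : IPC (Imp Bot A)
| IPC_mp A B : IPC (Imp A B) -> IPC A -> IPC B.

Definition intermediate_logic (L : set formula) : Prop :=
  [/\ IPC `<=` L,
      forall A B, L (Imp A B) -> L A -> L B &
      forall s A, L A -> L (subst s A)].

Definition axiomatized_by (L G : set formula) : Prop :=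
  [/\ intermediate_logic L, G `<=` L &
      forall L', intermediate_logic L' -> G `<=` L' -> L `<=` L'].

Record frame : Type := Frame {
  world :> Type;
  acc : relation world;
  acc_order : Relation_Definitions.order world acc;
  world_inhabited : inhabited world }.

Record valuation (F : frame) : Type := Valuation {
  truth_set :> nat -> set F;
  persistent : forall k (w v : F), acc w v -> truth_set k w -> truth_set k v }.

Fixpoint forces (F : frame) (V : valuation F) (w : F) (A : formula) : Prop :=
  match A with
  | Var k => V k w
  | Bot => False
  | And B C => forces V w B /\ forces V w C
  | Or B C => forces V w B \/ forces V w C
  | Imp B C => forall v : F, acc w v -> forces V v B -> forces V v C
  end.

Definition valid_on (F : frame) (A : formula) : Prop :=
  forall (V : valuation F) (w : F), forces V w A.

Definition refuted_on (F : frame) (A : formula) : Prop :=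
  exists (V : valuation F) (w : F), ~ forces V w A.

Definition finite_frame (F : frame) : Prop := finite_set [set: F].

Definition finite_model_property (L : set formula) : Prop :=
  forall A, ~ L A ->
    exists F : frame,
      [/\ finite_frame F, forall B, L B -> valid_on F B & refuted_on F A].

Fixpoint imp_free (A : formula) : bool :=
  match A with
  | Var _ | Bot => true
  | And B C | Or B C => imp_free B && imp_free C
  | Imp _ _ => false
  end.

Fixpoint NNIL (A : formula) : bool :=
  match A with
  | Var _ | Bot => true
  | And B C | Or B C => NNIL B && NNIL C
  | Imp B C => imp_free B && NNIL C
  end.

(* The fixed variables p_1, ..., p_n are [Var 0], ..., [Var n.-1]; restricting
   the valuation to them means that the other variables are true nowhere. *)
Record n_model (n : nat) : Type := NModel {
  n_frame :> frame;
  n_val : valuation n_frame;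
  n_val_restricted : forall k w, n <= k -> ~ n_val k w }.

Definition col (n : nat) (M : n_model n) (w : M) : n.-tuple bool :=
  [tuple `[< forces (n_val M) w (Var k) >] | k < n].

Definition color_preserving_monotonic (n : nat) (N M : n_model n)
    (f : N -> M) : Prop :=
  (forall w v : N, acc w v -> acc (f w) (f v)) /\
  (forall w : N, col (f w) = col w).

Definition MR_for (n : nat) (A : formula) : Prop :=
  forall (N M : n_model n) (f : N -> M), color_preserving_monotonic f ->
  forall w : N, forces (n_val M) (f w) A -> forces (n_val N) w A.

(* For A with variables among the first n ones, [MR_for n A] does not depend on
   n, so the existential quantifier could equally be a universal one. *)
Definition MR (A : formula) : Prop :=
  exists n, vars_below n A /\ MR_for n A.

(* Main.v *)
(* Every NNIL-formula is an MR-formula, so only MR-axioms matter. Given A not in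
   L, start from a prime L-theory omitting A and select a finite set N of prime
   L-theories: whenever an implication B -> C of A is omitted by a selected
   theory that also omits B, add an extension containing B and omitting C.
   Selection stops because each step decreases the number of antecedents
   omitted, and N, ordered by inclusion, refutes A. Since N is finite, each of
   its upsets is cut out by a single formula; hence for every valuation on N the
   inclusion of N into the canonical model of L, with a valuation given by a
   suitable substitution, is monotonic and color-preserving. All substitution
   instances of the axioms hold in the canonical model, so MR-axioms are valid
   on N. *)

Require Import Defs.
From HB Require Import structures.
From mathcomp Require Import all_boot.
From mathcomp Require Import boolp classical_sets cardinality.

Set Implicit Arguments.
Unset Strict Implicit.
Unset Printing Implicit Defensive.

Local Open Scope classical_set_scope.

HB.instance Definition _ := gen_eqMixin formula.

(** Makes the measure of the selection drop: [x] is counted by [b] but not by [a]. *)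
Lemma count_ltn (T : eqType) (a b : pred T) (s : seq T) x :
  subpred a b -> x \in s -> b x -> ~~ a x -> count a s < count b s.
Proof.
move=> ab + bx nax; elim: s => // y s IH; rewrite inE => /predU1P[<-|xs] /=.
  by rewrite bx (negbTE nax) add0n add1n ltnS sub_count.
have := IH xs; have := ab y; case: (a y) => [-> //|_ lt].
by rewrite add0n; apply: leq_trans lt _; exact: leq_addl.
Qed.

(** * Kripke semantics: persistence, substitution, soundness *)

Lemma forces_persistent (F : frame) (V : valuation F) A (w v : F) :
  acc w v -> forces V w A -> forces V v A.
Proof.
have [_ tr _] := acc_order F.
elim: A w v => [k|//|B IB C IC|B IB C IC|B _ C _] w v wv /=.
- exact: persistent wv.
- by case=> wB wC; split; [exact: IB wB|exact: IC wC].
- by case=> [wB|wC]; [left; exact: IB wB|right; exact: IC wC].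
- by move=> wBC u vu; apply: wBC; exact: tr vu.
Qed.

Definition subst_valuation (F : frame) (V : valuation F) (s : nat -> formula) :
  valuation F :=
  @Valuation F (fun k w => forces V w (s k))
    (fun k w v => @forces_persistent F V (s k) w v).

Lemma forces_subst (F : frame) (V : valuation F) s A (w : F) :
  forces V w (subst s A) <-> forces (subst_valuation V s) w A.
Proof.
elim: A w => [k|//|B IB C IC|B IB C IC|B IB C IC] w //=.
- by rewrite IB IC.
- by rewrite IB IC.
- by split=> h v wv /IB vB; apply/IC; exact: h.
Qed.

Lemma forces_IPC (F : frame) (V : valuation F) A (w : F) :
  IPC A -> forces V w A.
Proof.
have [rf tr _] := acc_order F.
move=> pA; elim: A / pA w => /=; try by [].
- move=> A B w v wv vA u vu _; exact: forces_persistent vA.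
- move=> A B C w v wv h u vu hAB t ut tA.
  by apply: (h t (tr _ _ _ vu ut) tA t (rf t)); exact: hAB.
- by move=> A B w v _ [].
- by move=> A B w v _ [].
- by move=> A B w v _ vA u vu uB; split=> //; exact: forces_persistent vA.
- by move=> A B w v _; left.
- by move=> A B w v _; right.
- move=> A B C w v _ hA u vu hB t ut [tA|tB]; last exact: hB.
  by apply: hA => //; exact: tr ut.
- by move=> A B _ hAB _ hA w; apply: (hAB w) => //; exact: rf.
Qed.

(** Since an axiomatized logic is the least one containing its axioms, checking the axioms on a
    frame then suffices. *)
Lemma valid_on_logic (F : frame) : intermediate_logic (valid_on F).
Proof.
have [rf _ _] := acc_order F.
split.
- by move=> A pA V w; exact: forces_IPC.
- by move=> A B hAB hA V w; exact: (hAB V w w (rf w) (hA V w)).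
- by move=> s A hA V w; apply/forces_subst; exact: hA.
Qed.

(** * NNIL-formulas are MR-formulas *)

Lemma vars_below_widen m n A : m <= n -> vars_below m A -> vars_below n A.
Proof.
move=> mn; elim: A => [k /leq_trans|//|B IB C IC|B IB C IC|B IB C IC] /=.
- exact.
- by case/andP=> /IB-> /IC.
- by case/andP=> /IB-> /IC.
- by case/andP=> /IB-> /IC.
Qed.

Lemma vars_below_exists A : exists n, vars_below n A.
Proof.
have max2 (B C : formula) : (exists n, vars_below n B) ->
    (exists n, vars_below n C) -> exists n, vars_below n B && vars_below n C.
  case=> m hB [n hC]; exists (maxn m n).
  by rewrite (vars_below_widen (leq_maxl m n) hB)
             (vars_below_widen (leq_maxr m n) hC).
elim: A => [k||B IB C IC|B IB C IC|B IB C IC] /=; try exact: max2.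
- by exists k.+1.
- by exists 0.
Qed.

Lemma forces_vars_below (F : frame) (V V' : valuation F) n A (w : F) :
  (forall k v, k < n -> V k v <-> V' k v) -> vars_below n A ->
  forces V w A <-> forces V' w A.
Proof.
move=> VV'; elim: A w => [k|//|B IB C IC|B IB C IC|B IB C IC] w /=.
- exact: VV'.
- by case/andP=> hB hC; rewrite IB// IC.
- by case/andP=> hB hC; rewrite IB// IC.
- by case/andP=> hB hC; split=> h v wv /IB vB; apply/IC => //; apply: h => //;
    exact: vB.
Qed.

(** Without implications, truth at a world depends only on its color, so it transfers both ways. *)
Lemma imp_free_col n (N M : n_model n) (f : N -> M) A (w : N) :
  color_preserving_monotonic f -> vars_below n A -> imp_free A ->
  forces (n_val M) (f w) A <-> forces (n_val N) w A.
Proof.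
case=> _ fcol; elim: A => [k|//|B IB C IC|B IB C IC|//] /=.
- move=> kn _; have := congr1 (fun t => tnth t (Ordinal kn)) (fcol w).
  by rewrite !tnth_mktuple /= => e; split=> h; apply/asboolP;
    [rewrite -e|rewrite e]; apply/asboolP.
- by case/andP=> hB hC /andP[fB fC]; rewrite IB// IC.
- by case/andP=> hB hC /andP[fB fC]; rewrite IB// IC.
Qed.

(** Induction on [A]. For an implication, [f] sends successors to successors; the implication-free
    antecedent is carried forward along [f], and the consequent is reflected back by induction. *)
Lemma NNIL_MR A : NNIL A -> MR A.
Proof.
have [n An] := vars_below_exists A; move=> nA; exists n; split=> // N M f cf.
elim: A An nA => [k|//|B IB C IC|B IB C IC|B _ C IC] /=.
- by move=> kn _ w fw; apply/(@imp_free_col n N M f (Var k)).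
- case/andP=> hB hC /andP[nB nC] w [fB fC].
  by split; [exact: IB|exact: IC].
- case/andP=> hB hC /andP[nB nC] w [fB|fC].
  + by left; exact: IB.
  + by right; exact: IC.
- case/andP=> hB hC /andP[nB nC] w fw v wv vB.
  apply: IC => //; apply: fw; first by case: cf => + _; exact.
  exact/imp_free_col.
Qed.

(** * Prime theories and Lindenbaum's lemma *)

Inductive derives (L X : set formula) : set formula :=
| derives_logic A : L A -> derives L X A
| derives_hyp A : X A -> derives L X A
| derives_mp A B : derives L X (Imp A B) -> derives L X A -> derives L X B.

Record prime_theory (L T : set formula) : Prop := PrimeTheory {
  prime_logic : L `<=` T;
  prime_mp : forall A B, T (Imp A B) -> T A -> T B;
  prime_consistent : ~ T Bot;
  prime_or : forall A B, T (Or A B) -> T A \/ T B }.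

Section Lindenbaum.
Variable L : set formula.
Hypothesis logicL : intermediate_logic L.

Let L_IPC A : IPC A -> L A.
Proof. by case: logicL => h _ _; exact: h. Qed.

(** The usual argument with K and S applies because [derives] has modus ponens but no substitution
    rule. *)
Lemma derives_deduction X A B :
  derives L (X `|` [set A]) B -> derives L X (Imp A B).
Proof.
have K C : derives L X C -> derives L X (Imp A C).
  by apply: derives_mp; apply: derives_logic; exact/L_IPC/IPC_K.
elim=> [C LC|C [XC|->]|C D _ hCD _ hC].
- exact/K/derives_logic.
- exact/K/derives_hyp.
- apply: (@derives_mp _ _ (Imp A (Imp A A))); last first.
    exact/derives_logic/L_IPC/IPC_K.
  apply: (@derives_mp _ _ (Imp A (Imp (Imp A A) A))); last first.
    exact/derives_logic/L_IPC/IPC_K.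
  exact/derives_logic/L_IPC/IPC_S.
- apply: derives_mp hC; apply: derives_mp hCD.
  exact/derives_logic/L_IPC/IPC_S.
Qed.

(** A derivation uses finitely many hypotheses, and finitely many members of a chain lie in the
    largest of them. The first alternative covers derivations using no member, as with the empty
    chain. *)
Lemma derives_compact X (F : set (set formula)) A : total_on F subset ->
  derives L (X `|` \bigcup_(Y in F) Y) A ->
  derives L X A \/ exists2 Y, F Y & derives L (X `|` Y) A.
Proof.
move=> totF.
have mono Y Z B : Y `<=` Z -> derives L Y B -> derives L Z B.
  move=> YZ; elim=> [C|C /YZ|C D _ + _].
  - exact: derives_logic.
  - exact: derives_hyp.
  - exact: derives_mp.
elim=> [B LB|B [XB|[Y FY YB]]|B C _ [hBC|[Y FY hBC]] _ [hB|[Z FZ hB]]].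
- by left; exact: derives_logic.
- by left; exact: derives_hyp.
- by right; exists Y => //; apply: derives_hyp; right.
- by left; exact: derives_mp hB.
- right; exists Z => //; apply: derives_mp hB.
  by apply: mono hBC; exact: subsetUl.
- right; exists Y => //; apply: derives_mp hBC _.
  by apply: mono hB; exact: subsetUl.
- have [YZ|ZY] := totF _ _ FY FZ; right.
  + exists Z => //; apply: derives_mp hB.
    by apply: mono hBC; exact: setUS.
  + exists Y => //; apply: derives_mp hBC _.
    by apply: mono hB; exact: setUS.
Qed.

Lemma lindenbaum X A : ~ derives L X A ->
  exists T, [/\ prime_theory L T, X `<=` T & ~ T A].
Proof.
move=> nA.
(* Zorn is applied to the sets added to [X], so that the empty chain also has an admissible
   union. *)
have [F FP Ftot|T [nTA maxT]] := @Zorn_bigcup _ [set Y | ~ derives L (X `|` Y) A].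
  by move=> /(derives_compact Ftot)[//|[Y /FP]].
(* By maximality, adding an underivable [B] yields [A]. Primeness follows: if both disjuncts imply
   [A], so does the disjunction. *)
have impA B : ~ derives L (X `|` T) B -> derives L (X `|` T) (Imp B A).
  move=> nB; apply: derives_deduction; rewrite -setUA; apply: contrapT.
  apply: maxT; split; first exact: subsetUl.
  by move=> /(_ B (or_intror erefl)) TB; apply/nB/derives_hyp; right.
exists (derives L (X `|` T)); split=> //.
- split.
  + exact: derives_logic.
  + by move=> B C; exact: derives_mp.
  + move=> bot; apply: nTA; apply: derives_mp bot.
    exact/derives_logic/L_IPC/IPC_efq.
  + move=> B C hBC.
    have [|/impA hB] := pselect (derives L (X `|` T) B); first by left.
    have [|/impA hC] := pselect (derives L (X `|` T) C); first by right.
    case: nTA; apply: derives_mp hBC; apply: derives_mp hC.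
    apply: derives_mp hB; exact/derives_logic/L_IPC/IPC_case.
- by move=> B XB; apply: derives_hyp; left.
Qed.

Lemma prime_IPC T A : prime_theory L T -> IPC A -> T A.
Proof. by move=> pT /L_IPC; exact: prime_logic. Qed.

Lemma prime_andE T A B : prime_theory L T -> T (And A B) <-> T A /\ T B.
Proof.
move=> pT; split=> [AB|[TA TB]].
- by split; apply: (prime_mp pT) AB; apply: prime_IPC => //; constructor.
- apply: (prime_mp pT) TB; apply: (prime_mp pT) TA.
  exact: (prime_IPC pT (IPC_pair _ _)).
Qed.

Lemma prime_orE T A B : prime_theory L T -> T (Or A B) <-> T A \/ T B.
Proof.
move=> pT; split=> [|[]]; first exact: (prime_or pT).
- by apply: (prime_mp pT); exact: (prime_IPC pT (IPC_orl _ _)).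
- by apply: (prime_mp pT); exact: (prime_IPC pT (IPC_orr _ _)).
Qed.

Lemma prime_imp_intro T A B : prime_theory L T -> T B -> T (Imp A B).
Proof. by move=> pT; apply: (prime_mp pT); exact: (prime_IPC pT (IPC_K _ _)). Qed.

Lemma prime_imp_extend T A B : prime_theory L T -> ~ T (Imp A B) ->
  exists T', [/\ prime_theory L T', T `<=` T', T' A & ~ T' B].
Proof.
move=> pT nAB.
have [|T' [pT' sT' nB]] := @lindenbaum (T `|` [set A]) B; last first.
  by exists T'; split=> // [C TC|]; apply: sT'; [left|right].
(* [T] contains [L] and is closed under modus ponens, so whatever is derived from it already belongs
   to it. *)
move=> /derives_deduction; move: (Imp A B) nAB => C + hC; apply.
elim: hC => // [D|D E _ + _]; [exact: (prime_logic pT)|exact: (prime_mp pT)].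
Qed.

(** * Truth lemma, finite selection and separation *)

Fixpoint implications (A : formula) : seq (formula * formula) :=
  match A with
  | Var _ | Bot => [::]
  | And B C | Or B C => implications B ++ implications C
  | Imp B C => (B, C) :: implications B ++ implications C
  end.

(** Worlds are labelled by prime theories, and witnesses are demanded only for the implications of
    [A]. This covers both the finite frame, with [Var] as [s], and the canonical model, with a
    substitution that encodes a valuation. *)
Lemma truth_lemma (F : frame) (V : valuation F) (th : F -> set formula) s A :
  (forall w v, acc w v -> th w `<=` th v) ->
  (forall w, prime_theory L (th w)) ->
  (forall k w, V k w <-> th w (s k)) ->
  (forall w p, p \in implications A -> ~ th w (subst s (Imp p.1 p.2)) ->
    exists v, [/\ acc w v, th v (subst s p.1) & ~ th v (subst s p.2)]) ->
  forall w, forces V w A <-> th w (subst s A).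
Proof.
move=> thS thP thV.
elim: A => [k|//|B IB C IC|B IB C IC|B IB C IC] /= sat w; first exact: thV.
- by split=> // /(prime_consistent (thP w)).
- rewrite (prime_andE _ _ (thP w)) IB ?IC// => v p pBC; apply: sat;
    by rewrite mem_cat pBC ?orbT.
- rewrite (prime_orE _ _ (thP w)) IB ?IC// => v p pBC; apply: sat;
    by rewrite mem_cat pBC ?orbT.
- have {}IB v : forces V v B <-> th v (subst s B).
    by apply: IB => u p pB; apply: sat; rewrite inE mem_cat pB orbT.
  have {}IC v : forces V v C <-> th v (subst s C).
    by apply: IC => u p pC; apply: sat; rewrite inE mem_cat pC !orbT.
  split=> [h|h v wv /IB vB].
  + apply: contrapT => nBC.
    have [|v [wv vB nC]] := sat w (B, C) _ nBC; first by rewrite inE eqxx.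
    by apply/nC/IC/h => //; exact/IB.
  + by apply/IC; apply: (prime_mp (thP v)) vB; exact: thS h.
Qed.

Definition saturated (Sigma : seq (formula * formula)) (N : set (set formula)) :=
  forall T p, N T -> p \in Sigma -> ~ T (Imp p.1 p.2) ->
  exists T', [/\ N T', T `<=` T', T' p.1 & ~ T' p.2].

Lemma finite_selection Sigma T : prime_theory L T ->
  exists N, [/\ finite_set N, N T, N `<=` prime_theory L & saturated Sigma N].
Proof.
have [m] := ubnP (count (fun p => `[< ~ T p.1 >]) Sigma).
elim: m T => // m IH T; rewrite ltnS => leTm pT.
(* For each pair that needs a witness, the induction hypothesis is applied to an extension of [T]
   containing the antecedent; other pairs get the empty set. *)
have /choice[N hN] : forall p, exists N, [/\ finite_set N, N `<=` prime_theory L,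
    saturated Sigma N & p \in Sigma -> ~ T (Imp p.1 p.2) -> ~ T p.1 ->
    exists T', [/\ N T', T `<=` T', T' p.1 & ~ T' p.2]].
  move=> p; have [[pS np n1]|nh] :=
    pselect [/\ p \in Sigma, ~ T (Imp p.1 p.2) & ~ T p.1]; last first.
    by exists set0; split=> // pS np n1; case: nh.
  have [T' [pT' TT' T'1 nT'2]] := prime_imp_extend pT np.
  have [||N [fN NT' Np sN]] := IH T'; [|exact: pT'|by exists N; split=> // _ _ _; exists T'].
  apply: leq_trans leTm.
  apply: (count_ltn _ pS) => [q /asboolP nq||].
  - by apply/asboolP => /TT'.
  - exact/asboolP.
  - by rewrite asbool_neg negbK; exact/asboolP.
exists (T |` \bigcup_(p in [set` Sigma]) N p); split.
- rewrite finite_setU; split; first exact: finite_set1.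
  by apply: bigcup_finite => [|p _]; [exact: finite_seq|case: (hN p)].
- by left.
- by move=> U [->//|[p _ NU]]; case: (hN p) => _ + _ _; exact.
- move=> U p [->|[q qS NU]] pS nU.
  (* If [T] contains the antecedent, it is its own witness: containing the consequent would give it
     the implication. *)
  + have [T1|n1] := pselect (T p.1).
      exists T; split=> //; first by left.
      by move=> T2; apply: nU; exact: prime_imp_intro.
    have [_ _ _ /(_ pS nU n1)[T' [NT' ? ? ?]]] := hN p.
    by exists T'; split=> //; right; exists p.
  + have [_ _ /(_ U p NU pS nU)[T' [NT' ? ? ?]] _] := hN q.
    by exists T'; split=> //; right; exists q.
Qed.

(** Each [T] in [X] has, for each [T'] in [Y], a formula missing from [T']. The conjunction over [Y]
    stays in [T]; the disjunction of these over [X] is omitted by every [T'], by primeness. *)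
Lemma prime_separate (X Y : set (set formula)) : finite_set X -> finite_set Y ->
  X `<=` prime_theory L -> Y `<=` prime_theory L ->
  (forall T T', X T -> Y T' -> ~ T `<=` T') ->
  exists D, (forall T, X T -> T D) /\ (forall T', Y T' -> ~ T' D).
Proof.
move=> /finite_seqP[s ->] /finite_seqP[t ->].
elim: s => [|T s IHs] pX pY nXY.
  by exists Bot; split=> // T' /pY; exact: prime_consistent.
have [D [sD tD]] : exists D, (forall T, T \in s -> T D) /\
    (forall T', T' \in t -> ~ T' D).
  apply: IHs => // [U Us|U T' Us]; [apply: pX|apply: nXY];
    by rewrite /= inE Us orbT.
have pT : prime_theory L T by apply: pX; rewrite /= inE eqxx.
have {}nXY T' : T' \in t -> ~ T `<=` T' by apply: nXY; rewrite /= inE eqxx.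
have [E [TE tE]] : exists E, T E /\ forall T', T' \in t -> ~ T' E.
  elim: t pY nXY {IHs tD} => [|U t IHt] pY nXY.
    exists (Imp Bot Bot); split=> //; exact: (prime_IPC pT (IPC_efq _)).
  have [||E [TE tE]] := IHt.
  - by move=> T' T't; apply: pY; rewrite /= inE T't orbT.
  - by move=> T' T't; apply: nXY; rewrite inE T't orbT.
  have pU : prime_theory L U by apply: pY; rewrite /= inE eqxx.
  have /existsNP[G /not_implyP[TG nUG]] : ~ T `<=` U by apply: nXY; rewrite inE eqxx.
  exists (And G E); split; first exact/prime_andE.
  move=> T' T't; rewrite prime_andE; last by apply: pY; exact: T't.
  by move: T't; rewrite inE => /predU1P[->|/tE nE] [].
exists (Or E D); split=> [U Us|T' T't].
- rewrite prime_orE; last exact: pX.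
  by move: Us; rewrite /= inE => /predU1P[->|/sD]; [left|right].
- rewrite prime_orE; last exact: pY.
  by case; [exact: tE|exact: tD].
Qed.

End Lindenbaum.

(** * Frames of theories and the finite model property *)

Definition theory_acc (S : set (set formula)) (x y : S) : Prop :=
  val x `<=` val y.

Lemma theory_acc_order (S : set (set formula)) :
  Relation_Definitions.order S (@theory_acc S).
Proof.
split=> [x A //|x y z xy yz A /xy/yz //|x y xy yx].
by apply: val_inj; apply/seteqP; split.
Qed.

Definition theory_frame (S : set (set formula)) (inhS : inhabited S) : frame :=
  Frame (@theory_acc_order S) inhS.

Definition restricted_valuation (F : frame) (V : valuation F) (n : nat) :
  valuation F.
Proof.
exists (fun k w => k < n /\ V k w).
by move=> k w v wv [kn Vw]; split=> //; exact: persistent Vw.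
Defined.

Definition restricted_model n (F : frame) (V : valuation F) : n_model n.
Proof.
exists F (restricted_valuation V n).
by move=> k w nk [kn _]; move: kn; rewrite ltnNge nk.
Defined.

Theorem theorem5p8 (L : set formula) :
  intermediate_logic L ->
  (exists G : set formula,
     (forall A, G A -> NNIL A) /\ axiomatized_by L G) \/
  (exists G : set formula,
     (forall A, G A -> MR A) /\ axiomatized_by L G) ->
  finite_model_property L.
Proof.
move=> logicL axL A nLA.
have {axL}[G [GMR [_ GL leastL]]] :
    exists G : set formula, (forall B, G B -> MR B) /\ axiomatized_by L G.
  case: axL => // -[G [GNNIL axG]]; exists G; split=> // B /GNNIL.
  exact: NNIL_MR.
have [|T [pT _ nTA]] := @lindenbaum L logicL set0 A.
  by move=> dA; apply: nLA; elim: dA => // B C _ + _; case: logicL => _ + _; exact.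
have [N [finN NT Np satN]] := finite_selection logicL (implications A) pT.
pose F := theory_frame (inhabits (exist _ T (mem_set NT) : N)).
have NE (w : F) : N (val w) by exact: set_valP.
exists F; split.
- by rewrite /finite_frame (eq_finite_set (card_setT N)).
- apply: (leastL _ (valid_on_logic F)) => B GB V w.
  have [n [Bn MRB]] := GMR _ GB.
  (* The worlds where [V k] holds are separated from the rest; an inclusion from the former into the
     latter would violate persistence. *)
  have /choice[s sV] : forall k, exists D, forall v : F, V k v <-> val v D.
    move=> k.
    have [||||v v'|D [XD YD]] := @prime_separate L logicL
      [set val v | v in [set v : F | V k v]]
      [set val v | v in [set v : F | ~ V k v]].
    + apply: sub_finite_set finN => _ [v _ <-]; exact: NE.
    + apply: sub_finite_set finN => _ [v _ <-]; exact: NE.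
    + by move=> _ [v _ <-]; exact/Np/NE.
    + by move=> _ [v _ <-]; exact/Np/NE.
    + move=> [u Vu <-] [u' nVu' <-] uu'; apply: nVu'.
      exact: (@persistent F V k u u' uu' Vu).
    + exists D => v; split=> [Vv|]; first by apply: XD; exists v.
      by apply: contraPP => nVv; apply: YD; exists v.
  (* [Bot] belongs to no prime theory, so [VC] is false from [n] on, as an [n]-model requires. *)
  pose s' k := if k < n then s k else Bot.
  pose P : set (set formula) := prime_theory L.
  pose C := theory_frame (inhabits (exist _ T (mem_set (pT : P T)) : P)).
  have Cp (v : C) : prime_theory L (val v) by exact: set_valP.
  pose VC : valuation C := @Valuation C (fun k v => val v (s' k))
    (fun k v u vu => vu (s' k)).
  have VCn k (v : C) : n <= k -> ~ VC k v.
    by rewrite /VC/= /s' leqNgt => /negbTE->; exact: (prime_consistent (Cp v)).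
  pose f (v : F) : C := exist _ (val v) (mem_set (Np _ (NE v) : P _)).
  have cf : @color_preserving_monotonic n (restricted_model n V) (NModel VCn) f.
    split=> // v; apply: eq_from_tnth => k; rewrite !tnth_mktuple /=.
    by apply: asbool_equiv_eq; rewrite /s' ltn_ord sV; split=> [|[]].
  (* By the truth lemma this says that [subst s' B] lies in the theory [f w], which contains [L]. *)
  have /(MRB _ _ _ cf) : forces VC (f w) B.
    apply/(@truth_lemma L logicL C VC (fun v => val v) s' B) => //.
    + move=> v p _ /(prime_imp_extend logicL (Cp v))[T' [pT' vT' T1 nT2]].
      by exists (exist _ T' (mem_set (pT' : P T'))).
    + apply: (prime_logic (Cp _)); case: logicL => _ _; apply; exact: GL.
  by apply: (iffLR (forces_vars_below _ _ Bn)) => k v kn /=; split=> [[]|].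
(* With the identity substitution, saturation of [N] supplies the witnesses of the truth lemma, and
   [A] fails at [T]. *)
- pose V : valuation F := @Valuation F (fun k v => val v (Var k))
    (fun k v u vu => vu (Var k)).
  exists V, (exist _ T (mem_set NT)).
  have substK B : subst Var B = B by elim: B => //= B -> C ->.
  move=> /(@truth_lemma L logicL F V (fun v => val v) Var A).
  rewrite substK; apply: contra_not nTA; apply => //.
  + by move=> v; exact/Np/NE.
  + move=> v p pA; rewrite !substK => /(satN _ _ (NE v) pA)[T' [NT' vT' T1 nT2]].
    by exists (exist _ T' (mem_set NT')).
Qed.
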